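(* Let $n\ge 2$, $m\ge 0$ be integers and let $\underline{Y}=(Y_1,\dots,Y_n)$, $\underline{X}=(X_1,\dots,X_m)$ be $n+m$ indeterminates over $\mathbb{F}_q$. Then the following equality holds in the rational function field $\mathbb{F}_q(\underline{Y},\underline{X})$: $$\frac{\Delta_n\big(\Delta_{n-1+m}(\underline{\hat Y_1},\underline{X}),\dots,(-1)^{i+1}\Delta_{n-1+m}(\underline{\hat Y_i},\underline{X}),\dots,(-1)^{n+1}\Delta_{n-1+m}(\underline{\hat Y_n},\underline{X})\big)}{\Delta_m(\underline{X})^{q^{n-1}}\,\Delta_{n+m}(\underline{Y},\underline{X})^{1+q+\cdots+q^{n-2}}}$$ $$=\frac{\Delta_n\big(\Delta_{n-1}(\underline{\hat Y_1}),\dots,(-1)^{i+1}\Delta_{n-1}(\underline{\hat Y_i}),\dots,(-1)^{n+1}\Delta_{n-1}(\underline{\hat Y_n})\big)}{\Delta_{n}(\underline{Y})^{1+q+\cdots+q^{n-2}}}.$$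
   Context: $q=p^s$ is a power of a prime $p$. For a commutative ring $A$ containing $\mathbb{F}_q$ and $\underline a=(a_1,\dots,a_n)\in A^n$ with $n\ge 1$, the Moore determinant is $\Delta_n(\underline a):=\det\big(a_j^{q^{i-1}}\big)_{1\le i,j\le n}$ (row $i$, column $j$). For $m=0$ the tuple $\underline{X}$ is empty and $\Delta_0:=1$. For $1\le i\le n$, $\underline{\hat Y_i}:=(Y_1,\dots,Y_{i-1},Y_{i+1},\dots,Y_n)$, and $(\underline{\hat Y_i},\underline X)$, $(\underline Y,\underline X)$ denote concatenated tuples. *)

(* Defs.v *)
From HB Require Import structures.
From mathcomp Require Export all_boot all_order all_algebra.
From mathcomp Require Export mpoly.

Set Implicit Arguments.
Unset Strict Implicit.
Unset Printing Implicit Defensive.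

Import GRing.Theory.
Local Open Scope ring_scope.

(* Tuples are row vectors. Rows are indexed from 0, so the exponent q ^ (i - 1)
   of the usual 1-based convention is q ^ i here; for k = 0 the determinant of
   the empty matrix is 1 (det_mx00). *)
Definition Moore (A : comNzRingType) (q k : nat) (a : 'rV[A]_k) : A :=
  \det (\matrix_(i < k, j < k) a 0 j ^+ (q ^ i)).

(* The tuple of the (-1)^(i+1) Delta (Y without Y_i, X) for 1-based i: with the
   0-based index j = i - 1 the sign is (-1)^j, and col' j Y drops entry j. *)
Definition signed_minors (A : comNzRingType) (q n m : nat)
    (Y : 'rV[A]_n) (X : 'rV[A]_m) : 'rV[A]_n :=
  \row_(j < n) ((-1) ^+ j * Moore q (row_mx (col' j Y) X)).

(* The case of the empty tuple X, kept separate to avoid the index n.-1 + 0. *)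
Definition signed_minors0 (A : comNzRingType) (q n : nat)
    (Y : 'rV[A]_n) : 'rV[A]_n :=
  \row_(j < n) ((-1) ^+ j * Moore q (col' j Y)).

(* Of the n + m variables of F(Y, X), the first n are the Y's, the last m the
   X's. *)
Definition indetY (F : fieldType) (n m : nat) :
    'rV[{fraction {mpoly F[n + m]}}]_n :=
  \row_(i < n) tofrac ('X_(lshift m i) : {mpoly F[n + m]}).

Definition indetX (F : fieldType) (n m : nat) :
    'rV[{fraction {mpoly F[n + m]}}]_m :=
  \row_(i < m) tofrac ('X_(rshift n i) : {mpoly F[n + m]}).

(* Main.v *)
(** Both sides of the equality are equal to 1. Put Z = (Y, X) and N = n + m, and
    let D_j = (-1)^j Delta (Z without Z_j) for all j < N. Up to sign D is the last
    column of the adjugate of the Moore matrix of Z, so the pairing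
    <D^(q^i), Z^(q^r)> vanishes for i <= r < i + N - 1; it is +-Delta(Z) for
    i = 0, r = N - 1 and Delta(Z)^(q^(i-1)) for r = i - 1. Complete the n rows
    D^(q^i) by the m rows (0 | 1) to a square matrix of determinant
    Delta_n(D_0, ..., D_(n-1)). Its product with the transposed Moore matrix of Z is,
    up to a cyclic shift of the columns, block triangular, with determinant
    Delta(Z) * Delta(Z)^(1 + q + ... + q^(n-2)) * Delta(X)^(q^(n-1)). Cancelling
    Delta(Z) gives the value 1, and the right-hand side is the case m = 0. *)

Require Import Defs.
From mathcomp Require Import all_boot all_order all_algebra.
From mathcomp Require Import all_fingroup all_field.
From mathcomp Require Import mpoly.

Set Implicit Arguments.
Unset Strict Implicit.
Unset Printing Implicit Defensive.

Import GRing.Theory.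
Local Open Scope ring_scope.

Lemma pchar_expr_rmorphism (A : comNzRingType) (p t : nat) :
  p \in [pchar A] -> exists f : {rmorphism A -> A}, forall x, f x = x ^+ (p ^ t).
Proof.
move=> charA; elim: t => [|t [f fE]]; first by exists idfun.
exists (pFrobenius_aut charA \o f) => x /=.
by rewrite fE pFrobenius_autE -exprM -expnSr.
Qed.

Section MoorePairing.

Variables (A : comNzRingType) (p s q : nat).
Hypotheses (charA : p \in [pchar A]) (qE : q = (p ^ s)%N).

(** Taking [q ^ i]-th powers is an iterated Frobenius, so it commutes with sums and determinants. *)
Lemma expr_q_rmorphism i :
  exists f : {rmorphism A -> A}, forall x, f x = x ^+ (q ^ i).
Proof. by rewrite qE -expnM; apply: pchar_expr_rmorphism. Qed.

Lemma Moore_expr k (a : 'rV[A]_k) i :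
  Moore q a ^+ (q ^ i) = \det (\matrix_(r < k, c < k) a 0 c ^+ (q ^ (i + r))).
Proof.
have [f fE] := expr_q_rmorphism i.
rewrite -fE -det_map_mx; congr (\det _); apply/matrixP=> r c.
by rewrite !mxE fE -exprM -expnD addnC.
Qed.

Definition cominor N (Z : 'rV[A]_N.+1) (j : 'I_N.+1) : A :=
  (-1) ^+ j * Moore q (col' j Z).

(** This is the last column of [M *m \adj M = (\det M)%:M]; the cofactor sign (-1)^(N + j) leaves
    (-1)^N. *)
Lemma cominor_pairing0 N (Z : 'rV[A]_N.+1) (r : 'I_N.+1) :
  \sum_j cominor Z j * Z 0 j ^+ (q ^ r) =
  (-1) ^+ N * Moore q Z *+ (r == ord_max).
Proof.
set M := \matrix_(i < N.+1, j < N.+1) Z 0 j ^+ (q ^ i).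
have /(congr1 (fun B : 'M_N.+1 => B r ord_max)) := mul_mx_adj M.
rewrite !mxE => /(congr1 (fun x => (-1) ^+ N * x)).
rewrite mulrnAr => <-; rewrite mulr_sumr; apply: eq_bigr => j _.
rewrite !mxE /cofactor exprD -[in RHS]mulrA (mulrCA (Z 0 j ^+ _)) signrMK.
rewrite mulrC; congr (_ * (_ * _)).
by rewrite /Moore; congr (\det _); apply/matrixP=> a b; rewrite !mxE lift_max.
Qed.

(** This is the [q ^ i]-th power of the vanishing pairing with exponent [r - i < N]. *)
Lemma cominor_pairing_eq0 N (Z : 'rV[A]_N.+1) i r :
  (i <= r < i + N)%N ->
  \sum_j cominor Z j ^+ (q ^ i) * Z 0 j ^+ (q ^ r) = 0.
Proof.
case/andP=> le_ir lt_r; have [f fE] := expr_q_rmorphism i.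
have lt_d : (r - i < N)%N by rewrite ltn_subLR.
have := cominor_pairing0 Z (widen_ord (leqnSn N) (Ordinal lt_d)).
rewrite -val_eqE /= ltn_eqF // mulr0n => /(congr1 f).
rewrite rmorph0 rmorph_sum => {2}<-; apply: eq_bigr => j _.
by rewrite rmorphM /= !fE -exprM -expnD subnK.
Qed.

(** For [i = 0] this is the expansion of the Moore determinant along its first row: the remaining
    rows start at exponent q, so each minor is the q-th power of a Moore determinant. The Frobenius
    gives the other [i]. *)
Lemma cominor_pairing_shift N (Z : 'rV[A]_N.+1) i :
  \sum_j cominor Z j ^+ (q ^ i.+1) * Z 0 j ^+ (q ^ i) = Moore q Z ^+ (q ^ i).
Proof.
have [f fE] := expr_q_rmorphism i; have [g gE] := expr_q_rmorphism 1.
rewrite -[in RHS]fE /Moore (expand_det_row _ ord0) rmorph_sum.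
apply: eq_bigr => j _; rewrite mxE expn0 expr1 rmorphM /= !fE mulrC; congr (_ * _).
rewrite expnS exprM; congr (_ ^+ _).
rewrite -[q]expn1 -gE rmorphM /= rmorph_sign /cofactor add0n gE Moore_expr.
by congr (_ * \det _); apply/matrixP=> a b; rewrite !mxE lift0.
Qed.

(** The factor [Moore q (row_mx Y X)] stays on both sides because [A] may have zero divisors. *)
Lemma Moore_signed_minorsM k m (Y : 'rV[A]_k.+1) (X : 'rV[A]_m) :
  Moore q (signed_minors q Y X) * Moore q (row_mx Y X) =
  Moore q X ^+ (q ^ k) * Moore q (row_mx Y X) ^+ (\sum_(i < k) q ^ i)
  * Moore q (row_mx Y X).
Proof.
(* The sizes [(k + m).+1] and [k.+1 + m] are convertible: the first serves expansions along a row,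
   the second block matrices. *)
pose Z : 'rV_((k + m).+1) := row_mx Y X.
pose M : 'M_((k + m).+1) := \matrix_(i, j) Z 0 j ^+ (q ^ i).
pose B : 'M[A]_(k.+1 + m) :=
  block_mx (\matrix_(i, j) signed_minors q Y X 0 j ^+ (q ^ i))
           (\matrix_(i, j) cominor Z (rshift k.+1 j) ^+ (q ^ i)) 0 1%:M.
pose C : 'M_((k + m).+1) := (B : 'M_((k + m).+1)) *m M^T.
have detB : \det B = Moore q (signed_minors q Y X).
  by rewrite det_ublock det1 mulr1.
have detC : \det C = Moore q (signed_minors q Y X) * Moore q Z.
  by rewrite det_mulmx det_tr -detB.
have BuE (i : 'I_k.+1) (j : 'I_(k.+1 + m)) :
    B (lshift m i) j = cominor Z j ^+ (q ^ i).
  have [j' ->|j' ->] := split_ordP j; last by rewrite block_mxEur mxE.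
  by rewrite block_mxEul !mxE /cominor col'Kl.
have BdE (l : 'I_m) (j : 'I_(k.+1 + m)) :
    B (rshift k.+1 l) j = (j == rshift k.+1 l)%:R.
  have [j' ->|j' ->] := split_ordP j.
    by rewrite block_mxEdl mxE eq_lrshift.
  by rewrite block_mxEdr mxE eq_rshift eq_sym.
have CuE (i : 'I_k.+1) c :
    C (lshift m i) c = \sum_j cominor Z j ^+ (q ^ i) * Z 0 j ^+ (q ^ c).
  rewrite mxE; apply: eq_bigr => j _; rewrite [M^T _ _]mxE [M _ _]mxE.
  by congr (_ * _); exact: BuE.
have CdE (l : 'I_m) c : C (rshift k.+1 l) c = X 0 l ^+ (q ^ c).
  rewrite mxE; under eq_bigr => j _ do rewrite [B _ _]BdE mulr_natl mulrb.
  rewrite -big_mkcond big_pred1_eq [M^T _ _]mxE [M _ _]mxE.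
  by congr (_ ^+ _); exact: row_mxEr.
(* Row 0 of [C] vanishes outside its last column, so only this minor matters. Its row [i < k] comes
   from row [i.+1] of [C], which puts the shifted pairings on the diagonal. *)
pose R : 'M_(k + m) := row' ord0 (col' ord_max C).
have RE i c : R i c = C (lift ord0 i) (lift ord_max c).
  by rewrite mxE [LHS]mxE.
have RuE (i : 'I_k) c :
    R (lshift m i) c = \sum_j cominor Z j ^+ (q ^ i.+1) * Z 0 j ^+ (q ^ c).
  rewrite RE; have -> : lift ord0 (lshift m i) = lshift m (lift ord0 i).
    exact: val_inj.
  by rewrite CuE lift_max lift0.
have Ru0 (i : 'I_k) (c : 'I_(k + m)) : (i < c)%N -> R (lshift m i) c = 0.
  by move=> lt_ic; rewrite RuE cominor_pairing_eq0 // lt_ic ltn_addl.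
have RdE (l : 'I_m) c : R (rshift k l) c = X 0 l ^+ (q ^ c).
  rewrite RE; have -> : lift ord0 (rshift k l) = rshift k.+1 l.
    exact: val_inj.
  by rewrite CdE lift_max.
have detR :
    \det R = Moore q X ^+ (q ^ k) * Moore q Z ^+ (\sum_(i < k) q ^ i).
  have ur0 : ursubmx R = 0.
    apply/matrixP=> i c; rewrite [LHS]mxE [LHS]mxE Ru0 ?mxE //=.
    exact: ltn_addr.
  (* The lower right block starts at column [k], hence the power [q ^ k] of [Moore q X]. *)
  rewrite -(submxK R) ur0 det_lblock mulrC; congr (_ * _).
    rewrite Moore_expr -det_tr; congr (\det _).
    by apply/matrixP=> c l; rewrite [LHS]mxE [LHS]mxE [LHS]mxE RdE [RHS]mxE.
  rewrite det_trig; last first.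
    by apply/is_trig_mxP => i c lt_ic; rewrite [LHS]mxE [LHS]mxE Ru0.
  rewrite expr_sum; apply: eq_bigr => i _.
  by rewrite [LHS]mxE [LHS]mxE RuE cominor_pairing_shift.
have C0E c : C ord0 c = (-1) ^+ (k + m) * Moore q Z *+ (c == ord_max).
  have -> : ord0 = lshift m ord0 :> 'I_(k.+1 + m) by exact: val_inj.
  rewrite CuE -cominor_pairing0; apply: eq_bigr => j _.
  by rewrite expn0 expr1.
(* The cofactor sign (-1)^(k + m) cancels the sign in [C0E]. *)
rewrite -detC (expand_det_row _ ord0) (bigD1 ord_max) //= big1 => [|c ne_c].
  rewrite addr0 C0E eqxx mulr1n /cofactor add0n -/R detR.
  by rewrite -[LHS]mulrA (mulrCA (Moore q Z)) signrMK mulrC.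
by rewrite C0E (negPf ne_c) mulr0n mul0r.
Qed.

End MoorePairing.

Lemma mnm_sum_inj N k (g : 'I_k -> 'I_N) (c : 'I_k -> nat) i :
  injective g -> (\sum_(j < k) U_(g j) *+ c j)%MM (g i) = c i.
Proof.
move=> inj_g; rewrite mnm_sumE (bigD1 i) //= big1 => [|j ne_ji].
  by rewrite mulmnE mnm1E eqxx mul1n addn0.
by rewrite mulmnE mnm1E (inj_eq inj_g) (negPf ne_ji) mul0n.
Qed.

(* The monomials of the Leibniz expansion are pairwise distinct, so the one of the
   identity permutation has coefficient 1. *)
Lemma Moore_tofrac_indet_neq0 (F : fieldType) N k (f : 'I_k -> 'I_N) q :
  injective f -> (1 < q)%N ->
  Moore q (\row_i tofrac ('X_(f i) : {mpoly F[N]})) != 0.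
Proof.
move=> inj_f q_gt1.
pose D := \det (\matrix_(i, j) 'X_(f j) ^+ (q ^ i) : 'M[{mpoly F[N]}]_k).
have -> : Moore q (\row_i tofrac ('X_(f i) : {mpoly F[N]})) = tofrac D.
  rewrite -det_map_mx; congr (\det _); apply/matrixP=> i j.
  by rewrite !mxE rmorphXn.
pose u := (\sum_(j < k) U_(f j) *+ q ^ j)%MM.
have coefE (t : 'S_k) :
    ((-1) ^+ t * \prod_i (\matrix_(i, j) 'X_(f j) ^+ (q ^ i) :
      'M[{mpoly F[N]}]_k) i (t i))@_u = (t == 1%g)%:R.
  under eq_bigr do rewrite mxE.
  rewrite mprodXnE mulr_sign; have [->|ne_t1] := eqVneq t 1%g.
    by under eq_bigr do rewrite perm1; rewrite odd_perm1 mcoeffX eqxx.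
  suff /negPf ne_m : (\sum_i U_(f (t i)) *+ q ^ i)%MM != u.
    by case: ifP => _; rewrite ?mcoeffN mcoeffX ne_m ?oppr0.
  apply: contra ne_t1 => /eqP eq_m; apply/eqP/permP=> i; rewrite perm1.
  (* The exponents of the variable [f (t i)] are [q ^ i] and [q ^ t i]. *)
  have := congr1 (fun v : 'X_{1.. N} => v (f (t i))) eq_m.
  rewrite /= (mnm_sum_inj _ _ inj_f).
  rewrite (@mnm_sum_inj _ _ (f \o t) _ i (inj_comp inj_f perm_inj)).
  by move/eqP; rewrite eqn_exp2l // => /eqP/val_inj.
have coefD : D@_u = 1.
  rewrite raddf_sum (eq_bigr (fun t => (t == 1%g)%:R)) => [|t _].
    by under eq_bigr do rewrite mulrb; rewrite -big_mkcond big_pred1_eq.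
  exact: coefE.
rewrite tofrac_eq0; apply/eqP => D0; move/eqP: coefD.
by rewrite D0 mcoeff0 eq_sym oner_eq0.
Qed.

(** Needed for an empty [X], since [k + 0] does not reduce to [k]. *)
Lemma Moore_castmx (A : comNzRingType) q k l (eq_kl : k = l) (a : 'rV[A]_k) :
  Moore q (castmx (erefl, eq_kl) a) = Moore q a.
Proof. by case: l / eq_kl; rewrite castmx_id. Qed.

Lemma Moore_row_mx0 (A : comNzRingType) q k (Y : 'rV[A]_k) (X : 'rV[A]_0) :
  Moore q (row_mx Y X) = Moore q Y.
Proof.
rewrite -(Moore_castmx q (addn0 k)); congr Moore; apply/rowP=> j.
rewrite castmxE -(row_mxEl Y X); congr (row_mx _ _ _ _); exact: val_inj.
Qed.

Lemma signed_minors_row_mx0 (A : comNzRingType) q n (Y : 'rV[A]_n) (X : 'rV[A]_0) :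
  signed_minors q Y X = signed_minors0 q Y.
Proof. by apply/rowP=> j; rewrite !mxE Moore_row_mx0. Qed.

Section MooreRatio.

Variables (K : fieldType) (p s q : nat).
Hypotheses (charK : p \in [pchar K]) (qE : q = (p ^ s)%N).

Lemma Moore_signed_minors_ratio k m (Y : 'rV[K]_k.+1) (X : 'rV[K]_m) :
  Moore q X != 0 -> Moore q (row_mx Y X) != 0 ->
  Moore q (signed_minors q Y X) /
    (Moore q X ^+ (q ^ k) * Moore q (row_mx Y X) ^+ (\sum_(i < k) q ^ i)) = 1.
Proof.
move=> X_neq0 YX_neq0.
have /(mulIf YX_neq0) -> := Moore_signed_minorsM charK qE Y X.
by rewrite divff // mulf_neq0 ?expf_neq0.
Qed.

Lemma Moore_signed_minors0_ratio k (Y : 'rV[K]_k.+1) :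
  Moore q Y != 0 ->
  Moore q (signed_minors0 q Y) / Moore q Y ^+ (\sum_(i < k) q ^ i) = 1.
Proof.
move=> Y_neq0; have X0E : Moore q (0 : 'rV[K]_0) = 1 by apply: det_mx00.
have := @Moore_signed_minors_ratio k 0 Y 0.
rewrite Moore_row_mx0 signed_minors_row_mx0 X0E expr1n mul1r.
by apply=> //; apply: oner_neq0.
Qed.

End MooreRatio.

Theorem corollary4p1 (p s q : nat) (hp : prime p) (hq : q = (p ^ s)%N)
    (F : finFieldType) (hF : #|F| = q) (n m : nat) (hn : (2 <= n)%N) :
  let Y : 'rV[{fraction {mpoly F[n + m]}}]_n := indetY F n m in
  let X : 'rV[{fraction {mpoly F[n + m]}}]_m := indetX F n m in
  let e : nat := (\sum_(i < n.-1) q ^ i)%N in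
  Moore q (signed_minors q Y X)
    / (Moore q X ^+ (q ^ n.-1) * Moore q (row_mx Y X) ^+ e)
  = Moore q (signed_minors0 q Y) / Moore q Y ^+ e.
Proof.
move=> Y X e.
have q_gt1 : (1 < q)%N by rewrite -hF finNzRing_gt1.
have charK : p \in [pchar {fraction {mpoly F[n + m]}}].
  apply: (rmorph_pchar (@tofrac _ \o @mpolyC (n + m) F)).
  by apply: card_finPcharP hp; rewrite hF hq.
have Y_neq0 : Moore q Y != 0 by apply: Moore_tofrac_indet_neq0 (@lshift_inj _ _) _.
have X_neq0 : Moore q X != 0 by apply: Moore_tofrac_indet_neq0 (@rshift_inj _ _) _.
have YX_neq0 : Moore q (row_mx Y X) != 0.
  have -> : row_mx Y X = \row_i tofrac ('X_i : {mpoly F[n + m]}).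
    by apply/rowP=> i; have [j ->|j ->] := split_ordP i;
      rewrite ?row_mxEl ?row_mxEr !mxE.
  exact: Moore_tofrac_indet_neq0.
(* Writing [n] as [k.+1] makes [n.-1] compute to [k], the form of both ratio lemmas. *)
case: n hn => [//|k] _ in Y X e charK Y_neq0 X_neq0 YX_neq0 *.
transitivity (1 : {fraction {mpoly F[k.+1 + m]}}).
  exact: (Moore_signed_minors_ratio charK hq X_neq0 YX_neq0).
exact: (esym (Moore_signed_minors0_ratio charK hq Y_neq0)).
Qed.
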